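(* Let $\mu\in\mathcal P$ and $n\in\mathbb N$. For every $x\in\Xi_n$ there exists a best $d_{\sf L}$-approximation of $\mu$, given $x$. Moreover, for $p\in\Pi_n$, the measure $\delta_x^p$ is a best $d_{\sf L}$-approximation of $\mu$, given $x$, if and only if, for every $j=0,\ldots,n$, $$x_j<x_{j+1}\ \Longrightarrow\ \ell_{F_\mu,[x_j,x_{j+1}]}(P_j)\le {\sf L}^{\bullet}(x),$$ and in this case $d_{\sf L}(\mu,\delta_x^p)=\omega\,{\sf L}^{\bullet}(x)$.
   Context: $\mathbb I\subset\mathbb R$ is a compact interval with Lebesgue measure $\lambda(\mathbb I)>0$, and $\mathcal P$ is the set of all Borel probability measures on $\mathbb I$. For $\mu\in\mathcal P$, $F_\mu(x)=\mu(\{y\in\mathbb I:y\le x\})$, $x\in\mathbb R$. Let $\omega=\max\{1,\lambda(\mathbb I)\}/\lambda(\mathbb I)$. The (normalized) Lévy distance is $$d_{\sf L}(\mu,\nu)=\omega\inf\{y\ge0: F_\mu(\cdot-y)-y\le F_\nu\le F_\mu(\cdot+y)+y\}.$$ For $n\in\mathbb N$: $\Xi_n=\{x\in\mathbb I^n:x_1\le\ldots\le x_n\}$, with $x_0:=-\infty$, $x_{n+1}:=+\infty$; $\Pi_n=\{p\in\mathbb R^n:p_j\ge0,\ \sum_{j=1}^np_j=1\}$, with $P_i=\sum_{j=1}^ip_j$ for $i=0,\ldots,n$ (so $P_0=0$, $P_n=1$); $\delta_x^p=\sum_{j=1}^np_j\delta_{x_j}$, where $\delta_a$ is the Dirac measure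 at $a$. Given $x\in\Xi_n$, $\delta_x^p$ is a best $d_{\sf L}$-approximation of $\mu$, given $x$, if $d_{\sf L}(\mu,\delta_x^p)\le d_{\sf L}(\mu,\delta_x^q)$ for all $q\in\Pi_n$. For non-decreasing $f:\mathbb R\to\overline{\mathbb R}=\mathbb R\cup\{\pm\infty\}$, put $f_\pm(x)=\lim_{\varepsilon\downarrow0}f(x\pm\varepsilon)$ for $x\in\mathbb R$, and $f_\pm(\pm\infty)=f(\pm\infty):=\lim_{x\to\pm\infty}f(x)$ (same sign for the argument and the limit). For an interval $J\subset\overline{\mathbb R}$ with $f_-(\sup J)<+\infty$ and $-f_+(\inf J)<+\infty$, define for $x\in\mathbb R$ $$\ell_{f,J}(x)=\inf\{y\ge0: f_-(\sup J-y)-y\le x\le f_+(\inf J+y)+y\},\qquad \ell_{f,J}^*=\min_{x\in\mathbb R}\ell_{f,J}(x).$$ (These are well-defined for $f=F_\mu$ and every $J$; one-point intervals are allowed.) For $x\in\Xi_n$, $${\sf L}^\bullet(x)=\max\{\ell_{F_\mu,[-\infty,x_1]}(0),\ \ell^*_{F_\mu,[x_1,x_2]},\ldots,\ell^*_{F_\mu,[x_{n-1},x_n]},\ \ell_{F_\mu,[x_n,+\infty]}(1)\}.$$ *)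

(* Defs.v *)
From HB Require Import structures.
From mathcomp Require Import all_boot all_order all_algebra.
From mathcomp Require Import all_classical all_reals all_analysis.
Set Implicit Arguments.
Unset Strict Implicit.
Unset Printing Implicit Defensive.
Import Order.TTheory GRing.Theory Num.Theory.
Import numFieldNormedType.Exports.
Local Open Scope classical_set_scope.
Local Open Scope ring_scope.

(* A Borel probability measure on a Borel set I is represented by a Borel
   probability measure on R that gives mass 1 to I. *)
Definition proba_on (R : realType) (I : set R)
    (mu : probability (measurableTypeR R) R) : Prop :=
  mu I = 1%E.

Definition distr_fun (R : realType) (I : set R) (mu : set R -> \bar R) (x : R) :
    \bar R :=
  mu [set y | I y /\ y <= x].

Definition levy_omega (R : realType) (I : set R) : R :=
  let l := fine (lebesgue_measure I) in Num.max 1 l / l.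

(* Defined on arbitrary set functions, so that it applies directly to finite
   combinations of Dirac measures. *)
Definition levy_dist (R : realType) (I : set R) (mu nu : set R -> \bar R) : R :=
  let F := distr_fun I mu in
  let G := distr_fun I nu in
  levy_omega I *
  inf [set y : R | 0 <= y /\
         forall t : R, (F (t - y)%R - y%:E <= G t <= F (t + y)%R + y%:E)%E].

Definition left_lim (R : realType) (f : R -> \bar R) (x : \bar R) : \bar R :=
  match x with
  | r%:E => lim (f t @[t --> r^'-])
  | +oo%E => lim (f t @[t --> +oo])
  | -oo%E => lim (f t @[t --> -oo])
  end.

Definition right_lim (R : realType) (f : R -> \bar R) (x : \bar R) : \bar R :=
  match x with
  | r%:E => lim (f t @[t --> r^'+])
  | +oo%E => lim (f t @[t --> +oo])
  | -oo%E => lim (f t @[t --> -oo])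
  end.

Definition ell (R : realType) (f : R -> \bar R) (J : set (\bar R)) (x : R) : R :=
  inf [set y : R | 0 <= y /\
    (left_lim f (ereal_sup J - y%:E) - y%:E <= x%:E
       <= right_lim f (ereal_inf J + y%:E) + y%:E)%E].

(* The least element of A; the default value 0 is only used if there is none. *)
Definition least (R : realType) (A : set R) : R :=
  xget 0 (A `&` lbound A).

Definition ell_star (R : realType) (f : R -> \bar R) (J : set (\bar R)) : R :=
  least (range (ell f J)).

(* The coordinates of x are indexed from 0, so those of [Xi I x] are
   x ord0 <= ... <= x ord_max; [xseq x] below restores the indexing from 1,
   with xseq x 0 = -oo and xseq x n.+1 = +oo. *)
Definition Xi (R : realType) (I : set R) (n : nat) (x : 'I_n -> R) : Prop :=
  (forall i, I (x i)) /\ (forall i j : 'I_n, (i <= j)%N -> x i <= x j).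

Definition xseq (R : realType) (n : nat) (x : 'I_n -> R) (j : nat) : \bar R :=
  if j is k.+1 then oapp (fun i : 'I_n => (x i)%:E) +oo%E (insub k) else -oo%E.

(* The j-th closed gap, from x_j to x_{j+1} with x indexed from 1. *)
Definition gap (R : realType) (n : nat) (x : 'I_n -> R) (j : nat) :
    set (\bar R) :=
  [set t | (xseq x j <= t <= xseq x j.+1)%E].

Definition Simplex (R : realType) (n : nat) (p : 'I_n -> R) : Prop :=
  (forall j, 0 <= p j) /\ \sum_(j < n) p j = 1.

(* P_i = p_1 + ... + p_i with p indexed from 1. *)
Definition psum (R : realType) (n : nat) (p : 'I_n -> R) (i : nat) : R :=
  \sum_(j < n | (j < i)%N) p j.

Definition dirac_comb (R : realType) (n : nat) (x p : 'I_n -> R) (A : set R) :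
    \bar R :=
  (\sum_(j < n) (p j)%:E * \d_(x j) A)%E.

Definition best_levy_approx (R : realType) (I : set R) (mu : set R -> \bar R)
    (n : nat) (x p : 'I_n -> R) : Prop :=
  forall q : 'I_n -> R, Simplex q ->
    levy_dist I mu (dirac_comb x p) <= levy_dist I mu (dirac_comb x q).

Definition Lbullet (R : realType) (I : set R) (mu : set R -> \bar R)
    (n : nat) (x : 'I_n -> R) : R :=
  let F := distr_fun I mu in
  \big[Num.max/(Num.max (ell F (gap x 0) 0) (ell F (gap x n) 1))]_(1 <= j < n)
    ell_star F (gap x j).

(* Main.v *)
Require Import Defs.
From mathcomp Require Import all_boot all_order all_algebra.
From mathcomp Require Import all_classical all_reals all_analysis.
From mathcomp Require Import measurable_realfun lra.
Import Order.TTheory GRing.Theory Num.Theory.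
Import numFieldNormedType.Exports.
Local Open Scope classical_set_scope.
Local Open Scope ring_scope.

Set Implicit Arguments.
Unset Strict Implicit.
Unset Printing Implicit Defensive.

(** Write F for the distribution function of mu. That of the measure with
    weights p at the points x is constant, equal to P_j, from x_j (included) to
    x_{j+1} (excluded). The inequalities between distribution functions that
    define the Lévy distance may therefore be tested one gap at a time: y is
    admissible exactly when, for every nondegenerate gap with end points a < b,
    - F (t - y) - y <= P_j for all t < b, and
    - P_j <= F (t + y) + y for all t > a.
    This is [fits F a b y P_j]. One-sided limits of a monotone function are
    bounded by c exactly when its values on the relevant side are, so [fits] is
    also the condition in the definition of [ell] ([ell_conditionP]). As [fits]
    is stable under enlarging y and under decreasing limits in y, the infimum
    defining [ell] is attained: [ell F J c <= y] iff [0 <= y] and y fits c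
    ([ell_le]). Hence, up to the factor omega, the Lévy distance is the largest
    of the numbers [ell F [x_j, x_{j+1}] P_j] over the nondegenerate gaps
    ([unscaled_levy_le]).

    Since P_0 = 0 and P_n = 1 whatever p is, and since a degenerate gap {a}
    has [ell_star] equal to 0 (take the level F a), this maximum is at least
    [Lbullet] ([Lbullet_le_unscaled_levy]). The point is that equality can be
    reached, that is, that levels fitting L := [Lbullet] can be chosen gap by
    gap and still increase with j, so as to come from nonnegative weights. The
    smallest level fitting L on a gap with right end b is the supremum of
    F (t - L) - L over t < b, called [low_level]; it increases with b, hence
    with j. Truncating it below at 0, and imposing 0 and 1 at the two ends,
    gives the partial sums [best_level] of an optimal p
    ([unscaled_levy_best_weights]). So the best approximations are the p whose
    largest [ell] is at most [Lbullet]. *)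

(** * One-sided limits of monotone functions *)

Section MonotoneLimits.
Context (R : realType) (f : R -> R).
Hypothesis f_nd : {homo f : s t / s <= t}.
Let F (t : R) : \bar R := (f t)%:E.

Let F_nd : {homo F : s t / s <= t >-> (s <= t)%E}.
Proof. by move=> s t st; rewrite lee_fin f_nd. Qed.

Lemma is_cvg_left_monotone (r : R) : cvg (F t @[t --> r^'-]).
Proof.
have /cvg_ex[l fl] : cvg (f t @[t --> r^'-]).
  apply: nondecreasing_at_left_is_cvgr.
    by near=> u => s t _ _; exact: f_nd.
  near=> u; exists (f r) => _ [t /= tur <-]; apply: f_nd.
  by move: tur; rewrite in_itv /= => /andP[_ /ltW].
by apply/cvg_ex; exists l%:E; apply: cvg_comp fl _; exact: cvg_id.
Unshelve. all: by end_near. Qed.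

(** By monotonicity the left limit at b is the supremum of the values to the
    left of b, also when b is infinite on the right. *)
Lemma left_lim_le (b : \bar R) (c : R) : b != -oo%E ->
  (left_lim F b <= c%:E)%E <-> (forall t, (t%:E < b)%E -> f t <= c).
Proof.
case: b => [r| |//] _ /=; split.
- move=> lc t; rewrite lte_fin => tr; rewrite -lee_fin.
  apply: le_trans lc; apply: lime_ge; first exact: is_cvg_left_monotone.
  by near=> s; apply: F_nd; near: s; exact: nbhs_left_ge.
- move=> h; apply: lime_le; first exact: is_cvg_left_monotone.
  near=> s; rewrite lee_fin; apply: h; rewrite lte_fin; near: s.
  exact: nbhs_left_lt.
- move=> lc t _; rewrite -lee_fin.
  apply: le_trans lc; apply: lime_ge; first exact: nondecreasing_is_cvge.
  by near=> s; apply: F_nd; near: s; exact: nbhs_pinfty_ge (num_real _).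
- move=> h; apply: lime_le; first exact: nondecreasing_is_cvge.
  by near=> s; rewrite lee_fin; apply: h; rewrite ltry.
Unshelve. all: by end_near. Qed.

Lemma right_lim_ge (a : \bar R) (c : R) : a != +oo%E ->
  (c%:E <= right_lim F a)%E <-> (forall t, (a < t%:E)%E -> c <= f t).
Proof.
have cvgNy : cvg (F t @[t --> -oo]).
  apply/cvg_ex; exists (ereal_inf (range (F \o -%R))).
  apply/cvgNy_compNP; apply: nonincreasing_cvge => s t st.
  by apply: F_nd; rewrite lerN2.
have cvgr (r : R) : cvg (F t @[t --> r^'+]).
  apply: nondecreasing_at_right_is_cvge.
  by near=> u => s t _ _; exact: F_nd.
case: a => [r| //|] _ /=; split.
- move=> lc t; rewrite lte_fin => tr; rewrite -lee_fin.
  apply: le_trans lc _; apply: lime_le; first exact: cvgr.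
  by near=> s; apply: F_nd; near: s; exact: nbhs_right_le.
- move=> h; apply: lime_ge; first exact: cvgr.
  near=> s; rewrite lee_fin; apply: h; rewrite lte_fin; near: s.
  exact: nbhs_right_gt.
- move=> lc t _; rewrite -lee_fin.
  apply: le_trans lc _; apply: lime_le; first exact: cvgNy.
  by near=> s; apply: F_nd; near: s; exact: nbhs_ninfty_le (num_real _).
- move=> h; apply: lime_ge; first exact: cvgNy.
  by near=> s; rewrite lee_fin; apply: h; rewrite ltNyr.
Unshelve. all: by end_near. Qed.
End MonotoneLimits.

(** * Levels fitting a gap *)

Section Fits.
Context (R : realType) (f : R -> R).

(** Closeness, at scale y, of f to the constant c over the gap from a to b: the
    graph of f, moved by y right and down, stays below c before b, and moved by
    y left and up, stays above c after a. Both end points are excluded, so that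
    no one-sided limit of f appears. *)
Definition fits (a b : \bar R) (y c : R) : Prop :=
  (forall t, (t%:E < b)%E -> f (t - y) - y <= c) /\
  (forall t, (a < t%:E)%E -> c <= f (t + y) + y).

Lemma lt_room_above (t : R) (b : \bar R) : (t%:E < b)%E ->
  exists2 e, 0 < e & forall d, d <= e -> ((t + d)%:E < b)%E.
Proof.
case: b => [r| |//] tb; last by exists 1 => // d _; rewrite ltry.
rewrite lte_fin in tb; exists ((r - t) / 2).
  by rewrite divr_gt0// subr_gt0.
by move=> d dle; rewrite lte_fin; lra.
Qed.

Lemma lt_room_below (t : R) (a : \bar R) : (a < t%:E)%E ->
  exists2 e, 0 < e & forall d, d <= e -> (a < (t - d)%:E)%E.
Proof.
case: a => [r|//|] ta; last by exists 1 => // d _; rewrite ltNyr.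
rewrite lte_fin in ta; exists ((t - r) / 2).
  by rewrite divr_gt0// subr_gt0.
by move=> d dle; rewrite lte_fin; lra.
Qed.

(** The strict inequalities on t leave room to absorb a small change of y in a
    translation of t: t - y does not change when (t, y) becomes (t + d, y + d),
    nor t + y when (t, y) becomes (t - d, y + d). *)
Lemma fits_closed (a b : \bar R) (y c : R) :
  (forall e, 0 < e -> fits a b (y + e) c) -> fits a b y c.
Proof.
move=> h; split=> t.
  move=> /lt_room_above[e0 e0_gt0 room]; apply/ler_addgt0Pr => e e_gt0.
  have d_gt0 : 0 < Num.min e e0 by rewrite lt_min e_gt0.
  have [/(_ (t + Num.min e e0)) + _] := h _ d_gt0.
  rewrite (_ : t + _ - (y + _) = t - y); last by lra.
  have de : Num.min e e0 <= e by rewrite ge_min lexx.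
  by move=> /(_ (room _ _)); rewrite ge_min lexx orbT => /(_ isT); lra.
move=> /lt_room_below[e0 e0_gt0 room]; apply/ler_addgt0Pr => e e_gt0.
have d_gt0 : 0 < Num.min e e0 by rewrite lt_min e_gt0.
have [_ /(_ (t - Num.min e e0))] := h _ d_gt0.
rewrite (_ : t - _ + (y + _) = t + y); last by lra.
have de : Num.min e e0 <= e by rewrite ge_min lexx.
by move=> /(_ (room _ _)); rewrite ge_min lexx orbT => /(_ isT); lra.
Qed.

Hypothesis f_nd : {homo f : s t / s <= t}.

Lemma fits_le (a b : \bar R) (y z c : R) :
  y <= z -> fits a b y c -> fits a b z c.
Proof.
move=> yz [hb ha]; split=> t lt_t.
  by apply: le_trans (hb _ lt_t); rewrite lerB// f_nd// lerB.
by apply: le_trans (ha _ lt_t) _; rewrite lerD// f_nd// lerD.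
Qed.

Hypothesis f_ge0 : forall t, 0 <= f t.
Hypothesis f_le1 : forall t, f t <= 1.

Lemma fits_1 (a b : \bar R) (c : R) : 0 <= c <= 1 -> fits a b 1 c.
Proof.
move=> /andP[c0 c1]; split=> t _.
  by have := f_le1 (t - 1); lra.
by have := f_ge0 (t + 1); lra.
Qed.

Lemma fits_large (a b : \bar R) (c : R) : fits a b (1 + `|c|) c.
Proof.
have := ler_norm c; have := ler_norm (- c); rewrite normrN => ? ?.
split=> t _.
  by have := f_le1 (t - (1 + `|c|)); lra.
by have := f_ge0 (t + (1 + `|c|)); lra.
Qed.

Section Gap.
Context (a b : \bar R) (J : set (\bar R)).
Hypotheses (a_fin : a != +oo%E) (b_fin : b != -oo%E).
Hypotheses (infJ : ereal_inf J = a) (supJ : ereal_sup J = b).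
Let F (t : R) : \bar R := (f t)%:E.

Lemma ell_conditionP (y c : R) :
  (left_lim F (ereal_sup J - y%:E) - y%:E <= c%:E
       <= right_lim F (ereal_inf J + y%:E) + y%:E)%E <-> fits a b y c.
Proof.
rewrite infJ supJ leeBlDr// -EFinD -leeBlDr// -EFinB.
have bN : (b - y%:E)%E != -oo%E by move: b_fin; case: (b).
have aN : (a + y%:E)%E != +oo%E by move: a_fin; case: (a).
split=> [/andP[]|[hb ha]].
  move=> /(left_lim_le f_nd _ bN) hb /(right_lim_ge f_nd _ aN) ha.
  split=> t lt_t.
    by rewrite lerBlDr hb// EFinB lteD2rE.
  by rewrite -lerBlDr ha// EFinD lteD2rE.
apply/andP; split.
  apply/(left_lim_le f_nd) => // t; rewrite lteBrDr// => /hb.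
  by rewrite addrK lerBlDr.
apply/(right_lim_ge f_nd) => // t; rewrite -lteBrDr// => /ha.
by rewrite subrK lerBlDr.
Qed.

(** The infimum defining [ell] is attained, because [fits] passes to decreasing
    limits in y. *)
Lemma ell_le (y c : R) : ell F J c <= y <-> 0 <= y /\ fits a b y c.
Proof.
rewrite /ell; set S := (X in inf X).
have SE z : S z <-> 0 <= z /\ fits a b z c.
  by split=> -[z0 /ell_conditionP].
have S0 : has_lbound S by exists 0 => z [].
have Sn : S !=set0.
  by exists (1 + `|c|); apply/SE; split; [rewrite addr_ge0|exact: fits_large].
split=> [Sy|/SE Sy]; last exact: ge_inf.
split; first by apply: le_trans Sy; apply: lb_le_inf => // z [].
apply: fits_closed => e e_gt0.
have [z Sz zlt] := inf_adherent e_gt0 (conj Sn S0).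
have /SE[_] := Sz; apply: fits_le; apply: ltW.
by apply: lt_le_trans zlt _; rewrite lerD2r.
Qed.

Lemma ell_ge0 (c : R) : 0 <= ell F J c.
Proof. by have /ell_le[] := lexx (ell F J c). Qed.

Lemma ell_fits (c : R) : fits a b (ell F J c) c.
Proof. by have /ell_le[] := lexx (ell F J c). Qed.

(** The least level that can fit a gap with right end b at scale y. *)
Definition low_level (y : R) : R :=
  sup [set f (t - y) - y | t in [set t | (t%:E < b)%E]].

Lemma low_level_ub (y t : R) : (t%:E < b)%E -> f (t - y) - y <= low_level y.
Proof.
move=> tb; apply: ub_le_sup; last by exists t.
by exists (1 - y) => _ [s _ <-]; rewrite lerD2r.
Qed.

Lemma low_level_le (y c : R) :
  (forall t, (t%:E < b)%E -> f (t - y) - y <= c) -> low_level y <= c.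
Proof.
move=> h; apply: ge_sup; last by move=> _ [t tb <-]; exact: h.
have [t tb] : exists t, (t%:E < b)%E.
  move: b_fin; case: (b) => [r|//|//] _; last by exists 0; rewrite ltry.
  by exists (r - 1); rewrite lte_fin; lra.
by exists (f (t - y) - y), t.
Qed.

(** A level fits iff it separates the lower bounds from the upper bounds, so the
    supremum of the lower bounds fits as soon as some level does. *)
Lemma fits_low_level (y : R) :
  (exists c, fits a b y c) -> fits a b y (low_level y).
Proof.
move=> [c [hb ha]]; split=> t lt_t; first exact: low_level_ub.
exact: le_trans (low_level_le hb) (ha _ lt_t).
Qed.

(** The minimum of [ell] over all levels is the least y at which some level
    fits. That least y exists: for y above the infimum m some level separates
    lower from upper bounds, these inequalities no longer mention the level,
    and they pass to the limit m by translating t as in [fits_closed]. *)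
Lemma ell_star_min :
  (exists c, ell_star F J = ell F J c) /\ forall c, ell_star F J <= ell F J c.
Proof.
suff [m mr lbm] : exists2 m, range (ell F J) m & lbound (range (ell F J)) m.
  have [[d _ dE] lb] :
      (range (ell F J) `&` lbound (range (ell F J))) (ell_star F J).
    by apply: xgetPex; exists m.
  by split; [exists d|move=> e; apply: lb; exists e].
pose S := [set y | 0 <= y /\ exists c, fits a b y c].
have Sn : S !=set0.
  by exists 1; split=> //; exists 0; apply: fits_1; rewrite lexx ler01.
have S0 : has_lbound S by exists 0 => z [].
pose m := inf S.
have m_ge0 : 0 <= m by apply: lb_le_inf => // z [].
have m_fits : exists c, fits a b m c.
  have mE e : 0 < e -> exists c, fits a b (m + e) c.
    move=> e_gt0; have [z [_ [c zc]] zlt] := inf_adherent e_gt0 (conj Sn S0).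
    by exists c; apply: fits_le zc; exact: ltW.
  exists (low_level m); split=> t lt_t; first exact: low_level_ub.
  apply: low_level_le => s lt_s.
  have [e1 e1_gt0 room1] := lt_room_below lt_t.
  have [e2 e2_gt0 room2] := lt_room_above lt_s.
  apply/ler_addgt0Pr => e e_gt0.
  pose d := Num.min (e / 2) (Num.min e1 e2).
  have d_gt0 : 0 < d by rewrite !lt_min divr_gt0// e1_gt0.
  have de : d <= e / 2 by rewrite ge_min lexx.
  have d1 : d <= e1 by rewrite !ge_min lexx orbT.
  have d2 : d <= e2 by rewrite !ge_min lexx !orbT.
  have [c [/(_ _ (room2 _ d2)) + /(_ _ (room1 _ d1))]] := mE _ d_gt0.
  rewrite (_ : s + d - (m + d) = s - m); last by lra.
  rewrite (_ : t - d + (m + d) = t + m); last by lra.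
  by lra.
exists m; last first.
  move=> _ [c _ <-]; apply: ge_inf => //; split; first exact: ell_ge0.
  by exists c; exact: ell_fits.
case: m_fits => c mc; exists c => //; apply/eqP; rewrite eq_le; apply/andP.
split; first by apply/ell_le.
by apply: ge_inf => //; split; [exact: ell_ge0|exists c; exact: ell_fits].
Qed.
End Gap.
End Fits.

(** * The distribution function of a probability measure *)

Section DistributionFunction.
Context (R : realType) (I : set R) (mu : probability (measurableTypeR R) R).
Hypothesis I_compact : compact I.

Let ray t : set (measurableTypeR R) := [set y | I y /\ y <= t].

Let measurable_ray t : measurable (ray t).
Proof.
rewrite (_ : ray t = I `&` `]-oo, t]).
  by apply: measurableI => //; exact: compact_measurable.
by apply/seteqP; split=> y /=; rewrite in_itv.
Qed.

Let ray_fin t : mu (ray t) \is a fin_num.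
Proof. exact: fin_num_measure. Qed.

Definition distr t : R := fine (distr_fun I mu t).

Lemma distr_funE : distr_fun I mu = fun t => (distr t)%:E.
Proof. by apply/funext => t; rewrite /distr fineK// ray_fin. Qed.

Lemma distr_nd : {homo distr : s t / s <= t}.
Proof.
move=> s t st; apply: fine_le; rewrite ?ray_fin//.
apply: le_measure; rewrite ?inE; [exact: measurable_ray..|].
by move=> y [Iy ys]; split=> //; exact: le_trans st.
Qed.

Lemma distr_ge0 t : 0 <= distr t.
Proof. exact: fine_ge0. Qed.

Lemma distr_le1 t : distr t <= 1.
Proof. by rewrite -lee_fin (fineK (ray_fin t)); apply: probability_le1. Qed.

(** Right continuity, in the only form that meets [fits]: continuity of mu from
    above along the rays ending at r + 1/(k+1). *)
Lemma distr_right_closed (r c : R) :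
  (forall t, r < t -> c <= distr t) -> c <= distr r.
Proof.
move=> h; pose u k := ray (r + k.+1%:R^-1).
have rayE : ray r = \bigcap_k u k.
  apply/seteqP; split=> [y [Iy yr] k _|y uy].
    by split=> //; rewrite (le_trans yr)// lerDl.
  split; first by have [] := uy 0%N Logic.I.
  rewrite leNgt; apply/negP => /ltr_add_invr[k ky].
  by have [_] := uy k Logic.I; rewrite leNgt ky.
rewrite -lee_fin (fineK (ray_fin r)).
have : mu \o u @ \oo --> mu (ray r).
  rewrite rayE; apply: nonincreasing_cvg_mu.
  - by rewrite -ge0_fin_numE//; exact: ray_fin.
  - by move=> k; exact: measurable_ray.
  - by rewrite -rayE; exact: measurable_ray.
  move=> k l kl; apply/subsetPset => y [Iy yl]; split=> //.
  by apply: le_trans yl _; rewrite lerD2l lef_pV2 ?posrE// ler_nat.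
move/cvge_to_ge; apply; near=> k => /=.
by rewrite -[mu _]fineK ?ray_fin// lee_fin; apply: h; rewrite ltrDl.
Unshelve. all: by end_near. Qed.
End DistributionFunction.

(** * Gaps between the support points *)

Section Gaps.
Context (R : realType) (n : nat) (x : 'I_n -> R).
Hypothesis x_nd : forall i j : 'I_n, (i <= j)%N -> x i <= x j.

Lemma xseqS (i : 'I_n) : xseq x i.+1 = (x i)%:E.
Proof. by rewrite /xseq/= valK. Qed.

Lemma xseq_out (j : nat) : (n <= j)%N -> xseq x j.+1 = +oo%E.
Proof. by move=> nj; rewrite /xseq/= insubN// -leqNgt. Qed.

Lemma xseq_nd (i j : nat) : (i <= j)%N -> (xseq x i <= xseq x j)%E.
Proof.
case: i j => [|i] [|j] // ij; first exact: leNye.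
have [jn|nj] := ltnP j n; last by rewrite (xseq_out nj) leey.
have i_n : (i < n)%N := leq_ltn_trans (ij : (i <= j)%N) jn.
by rewrite (xseqS (Ordinal i_n)) (xseqS (Ordinal jn)) lee_fin x_nd.
Qed.

Lemma xseq_lty (j : nat) : (j <= n)%N -> xseq x j != +oo%E.
Proof. by case: j => [//|j] jn; rewrite (xseqS (Ordinal jn)). Qed.

Lemma xseqS_gtNy (j : nat) : xseq x j.+1 != -oo%E.
Proof. by rewrite /xseq; case: insubP. Qed.

Lemma gap_inf (j : nat) : ereal_inf (gap x j) = xseq x j.
Proof.
apply/eqP; rewrite eq_le; apply/andP; split.
  by apply: ereal_inf_lbound; rewrite /gap /mkset lexx xseq_nd.
by apply: le_ereal_inf_tmp => t /andP[].
Qed.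

Lemma gap_sup (j : nat) : ereal_sup (gap x j) = xseq x j.+1.
Proof.
apply/eqP; rewrite eq_le; apply/andP; split.
  by apply: ge_ereal_sup => t /andP[].
by apply: ereal_sup_ubound; rewrite /gap /mkset lexx xseq_nd.
Qed.

(** Take the last j with x_j <= t. *)
Lemma gap_locate (t : R) :
  exists2 j, (j <= n)%N & (xseq x j <= t%:E < xseq x j.+1)%E.
Proof.
pose P j := (j <= n)%N && (xseq x j <= t%:E)%E.
have P0 : exists j, P j by exists 0%N; rewrite /P/= leNye.
have Pn j : P j -> (j <= n)%N by case/andP.
case: (ex_maxnP P0 Pn) => j /andP[jn xj] j_max; exists j => //.
rewrite xj andTb ltNge; apply/negP => xj1.
have [jltn|nj] := ltnP j n.
  by have := j_max j.+1; rewrite /P jltn xj1 => /(_ isT); rewrite ltnn.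
by move: xj1; rewrite (xseq_out nj) leye_eq.
Qed.

Lemma distr_dirac_comb (I : set R) (p : 'I_n -> R) (j : nat) (t : R) :
  (forall i, I (x i)) -> (xseq x j <= t%:E < xseq x j.+1)%E ->
  distr_fun I (dirac_comb x p) t = (psum p j)%:E.
Proof.
move=> Ix /andP[jt tj]; rewrite /distr_fun /dirac_comb /psum.
rewrite [in RHS]big_mkcond/= -sumEFin; apply: eq_bigr => i _.
rewrite diracE; have [ij|ji] := ltnP i j.
  rewrite mem_set ?mule1//; split=> //.
  by rewrite -lee_fin -xseqS (le_trans (xseq_nd ij)).
rewrite memNset ?mule0// => -[_]; apply/negP; rewrite -ltNge.
by rewrite -lte_fin -xseqS (lt_le_trans tj)// xseq_nd.
Qed.
End Gaps.

(** * Partial sums of weights *)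

Section PartialSums.
Context (R : realType) (n : nat).

Lemma psum0 (p : 'I_n -> R) : psum p 0 = 0.
Proof. by rewrite /psum big1// => i; rewrite ltn0. Qed.

Lemma psum_last (p : 'I_n -> R) : Simplex p -> psum p n = 1.
Proof. by move=> [_ <-]; apply: eq_bigl => i; rewrite ltn_ord. Qed.

Lemma psum_bounds (p : 'I_n -> R) (j : nat) : Simplex p -> 0 <= psum p j <= 1.
Proof.
move=> [p0 <-]; rewrite sumr_ge0//=.
rewrite [leRHS](bigID (fun i : 'I_n => (i < j)%N))/=.
by rewrite lerDl sumr_ge0.
Qed.

Lemma psum_increments (P : nat -> R) (j : nat) : (j <= n)%N ->
  psum (fun i : 'I_n => P i.+1 - P i) j = P j - P 0%N.
Proof.
move=> jn; rewrite -telescope_sumr// big_mkord.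
by rewrite (big_ord_widen _ (fun i => P i.+1 - P i) jn).
Qed.
End PartialSums.

(** * The Lévy distance as a maximum over the gaps *)

Section LevyDistance.
Context (R : realType) (I : set R) (mu : probability (measurableTypeR R) R).
Context (n : nat) (x : 'I_n -> R).
Hypotheses (I_compact : compact I) (x_Xi : Xi I x).
Let f := distr I mu.
Let f_nd := distr_nd mu I_compact : {homo f : s t / s <= t}.
Let f_ge0 := distr_ge0 I mu : forall t, 0 <= f t.
Let f_le1 := distr_le1 mu I_compact : forall t, f t <= 1.
Let x_nd := x_Xi.2.

Definition unscaled_levy (p : 'I_n -> R) : R :=
  inf [set y : R | 0 <= y /\ forall t : R,
    (distr_fun I mu (t - y)%R - y%:E <= distr_fun I (dirac_comb x p) t
       <= distr_fun I mu (t + y)%R + y%:E)%E].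

Lemma exists_real_between (a b : \bar R) :
  (a < b)%E -> exists s, (a <= s%:E < b)%E.
Proof.
case: a b => [r| |] [s| |]//= ab.
- by exists r; rewrite lexx.
- by exists r; rewrite lexx ltry.
- by exists (s - 1); rewrite leNye lte_fin; lra.
- by exists 0; rewrite leNye ltry.
Qed.

(** Both distribution functions being monotone, the inequalities of the Lévy
    distance at the points t of a gap imply the one-sided ones of [fits] at all
    t, by comparison with a point of that gap. Conversely [fits] says nothing
    about the upper bound at t = x_j, where right continuity of the
    distribution function takes over. *)
Lemma levy_conditionP (p : 'I_n -> R) (y : R) :
  (forall t : R,
    (distr_fun I mu (t - y)%R - y%:E <= distr_fun I (dirac_comb x p) t
       <= distr_fun I mu (t + y)%R + y%:E)%E) <->
  (forall j, (j <= n)%N -> (xseq x j < xseq x j.+1)%E ->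
     fits f (xseq x j) (xseq x j.+1) y (psum p j)).
Proof.
have stepE t j : (xseq x j <= t%:E < xseq x j.+1)%E ->
  (distr_fun I mu (t - y)%R - y%:E <= distr_fun I (dirac_comb x p) t
     <= distr_fun I mu (t + y)%R + y%:E)%E
  = (f (t - y) - y <= psum p j <= f (t + y) + y).
  move=> jt; rewrite (distr_dirac_comb x_nd _ _ jt); last exact: x_Xi.1.
  by rewrite distr_funE// -EFinB -EFinD !lee_fin.
split=> [levy j jn ab|gaps t]; last first.
  have [j jn jt] := gap_locate x t.
  rewrite (stepE t j)//.
  have /andP[jt1 jt2] := jt.
  have [hb ha] := gaps j jn (le_lt_trans jt1 jt2).
  rewrite hb//= -lerBlDr; apply: (distr_right_closed I_compact) => s ts.
  rewrite lerBlDr -[s](subrK y); apply: ha.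
  by apply: le_lt_trans jt1 _; rewrite lte_fin ltrBrDr.
have [s /[dup] js /andP[js1 js2]] := exists_real_between ab.
have := levy s; rewrite (stepE s j)// => /andP[sb sa].
split=> t lt_t.
  have [at_|ta] := leP (xseq x j) t%:E.
    by have := levy t; rewrite (stepE t j) ?at_// => /andP[].
  apply: le_trans sb; rewrite lerD2r f_nd// lerD2r -lee_fin.
  exact: le_trans (ltW ta) js1.
have [tb|bt] := ltP t%:E (xseq x j.+1).
  by have := levy t; rewrite (stepE t j) ?(ltW lt_t)// => /andP[].
apply: le_trans sa _; rewrite lerD2r f_nd// lerD2r -lee_fin.
exact: le_trans (ltW js2) bt.
Qed.

Lemma ell_gap_le (j : nat) (y c : R) : (j <= n)%N ->
  ell (distr_fun I mu) (gap x j) c <= y <->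
  0 <= y /\ fits f (xseq x j) (xseq x j.+1) y c.
Proof.
move=> jn; rewrite distr_funE//.
apply: (ell_le f_nd f_ge0 f_le1); [exact: xseq_lty|exact: xseqS_gtNy|..].
  exact: gap_inf.
exact: gap_sup.
Qed.

Lemma ell_star_gap_min (j : nat) : (j <= n)%N ->
  let F := distr_fun I mu in
  (exists c, ell_star F (gap x j) = ell F (gap x j) c) /\
  forall c, ell_star F (gap x j) <= ell F (gap x j) c.
Proof.
move=> jn; rewrite /= distr_funE//.
apply: (@ell_star_min _ f f_nd f_ge0 f_le1 (xseq x j) (xseq x j.+1));
  [exact: xseq_lty|exact: xseqS_gtNy|..].
  exact: gap_inf.
exact: gap_sup.
Qed.

Lemma first_gap_nonempty : (xseq x 0 < xseq x 1)%E.
Proof. by rewrite ltNye xseqS_gtNy. Qed.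

Lemma last_gap_nonempty : (xseq x n < xseq x n.+1)%E.
Proof. by rewrite [ltRHS]xseq_out// ltey xseq_lty. Qed.

(** There are finitely many gaps and each [ell] is a lower bound of the set of
    admissible y, so the infimum is the maximum of the [ell]. The first gap,
    which is never degenerate, is what forces y to be nonnegative. *)
Lemma unscaled_levy_le (p : 'I_n -> R) (y : R) : Simplex p ->
  unscaled_levy p <= y <->
  (forall j, (j <= n)%N -> (xseq x j < xseq x j.+1)%E ->
     ell (distr_fun I mu) (gap x j) (psum p j) <= y).
Proof.
move=> p_S; rewrite /unscaled_levy; set S := (X in inf X).
have SE z : S z <-> forall j, (j <= n)%N -> (xseq x j < xseq x j.+1)%E ->
     ell (distr_fun I mu) (gap x j) (psum p j) <= z.
  split=> [[z0 /levy_conditionP h] j jn jgap|h].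
    by apply/ell_gap_le => //; split=> //; exact: h.
  split; first by have /ell_gap_le[] := h _ (leq0n _) first_gap_nonempty.
  apply/levy_conditionP => j jn jgap.
  by have /(ell_gap_le _ _ jn)[] := h j jn jgap.
split=> [Sy j jn jgap|/SE Sy]; last by apply: ge_inf => //; exists 0 => z [].
apply: le_trans Sy; apply: lb_le_inf; last by move=> z /SE; exact.
exists 1; apply/SE => k kn kgap; apply/ell_gap_le => //; split=> //.
by apply: fits_1 => //; exact: psum_bounds.
Qed.

(** * Comparison with the lower bound *)

Lemma Lbullet_ge_first : ell (distr_fun I mu) (gap x 0) 0 <= Lbullet I mu x.
Proof.
rewrite /Lbullet; apply: le_trans (bigmax_ge_id _ _ _ _).
by rewrite le_max lexx.
Qed.

Lemma Lbullet_ge_last : ell (distr_fun I mu) (gap x n) 1 <= Lbullet I mu x.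
Proof.
rewrite /Lbullet; apply: le_trans (bigmax_ge_id _ _ _ _).
by rewrite le_max lexx orbT.
Qed.

Lemma Lbullet_ge_star (j : nat) : (0 < j < n)%N ->
  ell_star (distr_fun I mu) (gap x j) <= Lbullet I mu x.
Proof.
move=> jn; rewrite /Lbullet.
by apply: (@le_bigmax_seq _ _ _ _ _ j xpredT) => //; rewrite mem_index_iota.
Qed.

Lemma Lbullet_ge0 : 0 <= Lbullet I mu x.
Proof. by have /ell_gap_le[] := Lbullet_ge_first. Qed.

(** For every p the outer levels are 0 and 1, and an inner nondegenerate gap
    contributes at least the minimum of its [ell]. A degenerate inner gap does
    not enter the distance, but its [ell_star] vanishes: the value of f at
    the common end point fits at every y >= 0. *)
Lemma Lbullet_le_unscaled_levy (p : 'I_n -> R) : Simplex p ->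
  Lbullet I mu x <= unscaled_levy p.
Proof.
move=> p_S; have /(unscaled_levy_le _ p_S) h := lexx (unscaled_levy p).
rewrite /Lbullet big_nat; apply: bigmax_le.
  rewrite ge_max -{1}(psum0 p) -{1}(psum_last p_S).
  by rewrite !h//; [exact: last_gap_nonempty|exact: first_gap_nonempty].
move=> j /andP[j_gt0 jn].
have [_ star_le] := ell_star_gap_min (ltnW jn).
have [jgap|jgap] := ltP (xseq x j) (xseq x j.+1).
  by apply: le_trans (star_le _) (h _ (ltnW jn) jgap).
have xE : xseq x j.+1 = (x (Ordinal jn))%:E by exact: (xseqS x (Ordinal jn)).
apply: le_trans (star_le (f (x (Ordinal jn)))) _.
apply/ell_gap_le; first exact: ltnW.
have r0 : 0 <= unscaled_levy p.
  by have /ell_gap_le[] := h _ (leq0n _) first_gap_nonempty.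
split=> //; split=> t lt_t.
  rewrite xE lte_fin in lt_t.
  have : f (t - unscaled_levy p) <= f (x (Ordinal jn)).
    by apply: f_nd; rewrite lerBlDr (le_trans (ltW lt_t))// lerDl.
  by lra.
have : f (x (Ordinal jn)) <= f (t + unscaled_levy p).
  apply: f_nd; rewrite -lee_fin -xE; apply: le_trans jgap _.
  by apply: le_trans (ltW lt_t) _; rewrite lee_fin lerDl.
by lra.
Qed.

(** Partial sums of an optimal p: in each inner gap the least fitting level at
    scale [Lbullet], truncated to be nonnegative. It never exceeds 1 because f
    does not. *)
Definition best_level (j : nat) : R :=
  if j == 0%N then 0
  else if (j < n)%N then Num.max 0 (low_level f (xseq x j.+1) (Lbullet I mu x))
  else 1.

(** Moving the right end of the gap to the right enlarges the set over which
    [low_level] is a supremum. *)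
Lemma best_level_nd (j : nat) : (0 < n)%N -> best_level j <= best_level j.+1.
Proof.
move=> n_gt0; rewrite /best_level/=.
have low_le1 i : low_level f (xseq x i.+1) (Lbullet I mu x) <= 1.
  apply: low_level_le; first exact: xseqS_gtNy.
  move=> t _; have := f_le1 (t - Lbullet I mu x); have := Lbullet_ge0; lra.
have [_|j_gt0] := eqVneq j 0%N; first by case: ifP; rewrite // le_max lexx.
have [jn1|nj1] := ltnP j.+1 n; last first.
  by case: ifP => // _; rewrite ge_max ler01 low_le1.
rewrite (ltnW jn1) ge_max le_max lexx/= le_max; apply/orP; right.
apply: low_level_le; first exact: xseqS_gtNy.
move=> t tb; apply: low_level_ub => //.
by exact: lt_le_trans tb (xseq_nd x_nd (leqnSn j.+1)).
Qed.

Definition best_weights (i : 'I_n) : R := best_level i.+1 - best_level i.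

Lemma psum_best_weights (j : nat) : (j <= n)%N ->
  psum best_weights j = best_level j.
Proof.
by move=> jn; rewrite psum_increments// [best_level 0]/best_level subr0.
Qed.

Lemma best_weights_Simplex : (0 < n)%N -> Simplex best_weights.
Proof.
move=> n_gt0; split=> [i|]; first by rewrite subr_ge0 best_level_nd.
transitivity (psum best_weights n).
  by apply: eq_bigl => i; rewrite ltn_ord.
by rewrite psum_best_weights// /best_level ltnn gtn_eqF.
Qed.

(** Some level fits each inner gap at scale [Lbullet], since [Lbullet] is at
    least its [ell_star]; then so does the least one, and truncating at 0 is
    harmless because the upper bounds f (t + y) + y are nonnegative. *)
Lemma unscaled_levy_best_weights :
  (0 < n)%N -> unscaled_levy best_weights <= Lbullet I mu x.
Proof.
move=> n_gt0; apply/unscaled_levy_le; first exact: best_weights_Simplex.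
move=> j jn jgap; rewrite psum_best_weights// /best_level.
have [->|j0] := eqVneq j 0%N; first exact: Lbullet_ge_first.
have [jltn|nj] := ltnP j n; last first.
  have -> : j = n by apply/eqP; rewrite eqn_leq jn.
  exact: Lbullet_ge_last.
apply/ell_gap_le => //; split; first exact: Lbullet_ge0.
have [[c cE] _] := ell_star_gap_min jn.
have := @Lbullet_ge_star j; rewrite lt0n j0 jltn cE => /(_ isT).
move=> /(ell_gap_le _ _ jn)[L0 c_fits].
have [hb ha] : fits f (xseq x j) (xseq x j.+1) (Lbullet I mu x)
    (low_level f (xseq x j.+1) (Lbullet I mu x)).
  by apply: fits_low_level; [exact: f_le1|exact: xseqS_gtNy|exists c].
split=> t lt_t; first by rewrite le_max hb ?orbT.
by rewrite ge_max ha// addr_ge0.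
Qed.
End LevyDistance.

(** * The theorem *)

Lemma levy_omega_gt0 (R : realType) (I : set R) : compact I ->
  (0 < lebesgue_measure I)%E -> 0 < levy_omega I.
Proof.
move=> I_compact I_pos; rewrite /levy_omega divr_gt0//.
  by rewrite lt_max ltr01.
by rewrite fine_gt0// I_pos compact_finite_measure.
Qed.

Theorem theorem3p5 (R : realType) (I : set R)
    (I_itv : is_interval I) (I_compact : compact I)
    (I_pos : (0 < lebesgue_measure I)%E)
    (mu : probability (measurableTypeR R) R) (mu_I : proba_on I mu)
    (n : nat) (n_gt0 : (0 < n)%N) (x : 'I_n -> R) (x_Xi : Xi I x) :
  (exists p : 'I_n -> R, Simplex p /\ best_levy_approx I mu x p) /\
  (forall p : 'I_n -> R, Simplex p ->
     (best_levy_approx I mu x p <->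
        (forall j : nat, (j <= n)%N -> (xseq x j < xseq x j.+1)%E ->
           ell (distr_fun I mu) (gap x j) (psum p j) <= Lbullet I mu x)) /\
     (best_levy_approx I mu x p ->
        levy_dist I mu (dirac_comb x p) = levy_omega I * Lbullet I mu x)).
Proof.
have omega_gt0 := levy_omega_gt0 I_compact I_pos.
have levyE p :
    levy_dist I mu (dirac_comb x p) = levy_omega I * unscaled_levy I mu x p.
  by [].
pose b := best_weights I mu x.
have b_S : Simplex b by exact: best_weights_Simplex.
have b_le : unscaled_levy I mu x b <= Lbullet I mu x.
  exact: unscaled_levy_best_weights.
have bestP p : Simplex p ->
    best_levy_approx I mu x p <-> unscaled_levy I mu x p <= Lbullet I mu x.
  move=> p_S; split=> [p_best|p_le q q_S].
    by apply: le_trans b_le; have := p_best b b_S; rewrite !levyE ler_pM2l.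
  by rewrite !levyE ler_pM2l// (le_trans p_le)// Lbullet_le_unscaled_levy.
split; first by exists b; split=> //; apply/bestP.
move=> p p_S; split.
  exact: iff_trans (bestP _ p_S) (unscaled_levy_le mu I_compact x_Xi _ p_S).
move=> /(bestP _ p_S) p_le; rewrite levyE; congr (_ * _).
by apply/eqP; rewrite eq_le p_le Lbullet_le_unscaled_levy.
Qed.
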